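(* Let $\mathcal M=(\mathcal S,\mathcal A,T,R,d_0,\gamma)$ be a Markov decision process with finite state space $\mathcal S$, discrete action space $\mathcal A$ and discount factor $\gamma\in[0,1)$, and let $P^\mu$ be the distribution of observed state-action pairs. Assume that $P^\mu(s,a)\ge\psi$ for some $\psi>0$ and all $(s,a)\in\mathcal S\times\mathcal A$. Let $Q_m:\mathcal S\times\mathcal A\to\mathbb R$ be a Q-function, let $\hat m(Q_m)$ be an estimate of $\|Q_m-\mathcal B^*Q_m\|_{P^\mu}$ with absolute estimation error $e(\hat m(Q_m))=\bigl|\hat m(Q_m)-\|Q_m-\mathcal B^*Q_m\|_{P^\mu}\bigr|$, and assume $\hat m(Q_m)\le\epsilon$ and $e(\hat m(Q_m))\le\delta$. Then (i) $\displaystyle \|Q_m-Q^*\|_{P^\mu}\le\frac{1}{\sqrt{\psi}\,(1-\gamma)}(\epsilon+\delta)$, and (ii) $\displaystyle J(\pi^* )-J(\pi_{Q_m})\le\frac{2}{\psi(1-\gamma)^2}(\epsilon+\delta)$.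
   Context: The MDP has transition probabilities $T(s'\mid s,a)$, rewards $R_t=R(S_t,A_t,S_{t+1})$ given by a real-valued function $R(s,a,s')$, initial state distribution $d_0$ and discount factor $\gamma$. The distribution $P^\mu$ has the form $P^\mu(s,a)=d^\mu(s)\mu(a\mid s)$, where $\mu$ is the behavioral policy and $d^\mu$ is a distribution on states (the marginal distribution of states over time points induced by $\mu$ and $\mathcal M$). For a function $f$ of state-action pairs, $\|f\|_{P^\mu}^2=\mathbb E_{(s,a)\sim P^\mu}[f(s,a)^2]$. A Q-function is any real-valued function on $\mathcal S\times\mathcal A$. The Bellman operator is $(\mathcal B^*Q)(s,a)=\mathbb E[R_t+\gamma\max_{a'}Q(S_{t+1},a')\mid S_t=s,A_t=a]$. For a policy $\pi$, $Q^\pi(s,a)=\mathbb E_\pi[\sum_{t\ge0}\gamma^tR_t\mid S_0=s,A_0=a]$ and $J(\pi)=\mathbb E_\pi[\sum_{t\ge0}\gamma^tR_t]$ with $S_0\sim d_0$. $Q^*$ is the optimal action-value function (the unique fixed point of $\mathcal B^*$), $\pi_Q(s)\in\operatorname{argmax}_aQ(s,a)$ denotes the greedy policy of $Q$, and $\pi^*=\pi_{Q^*}$ is an optimal policy. *)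

(* Defs.v *)
(* MathComp-Analysis; the reals are an arbitrary [R : realType]. *)
From HB Require Import structures.
From mathcomp Require Export all_boot all_order all_algebra.
From mathcomp Require Export all_classical all_reals all_analysis.

Set Implicit Arguments.
Unset Strict Implicit.
Unset Printing Implicit Defensive.

Import Order.TTheory GRing.Theory Num.Theory.
Import numFieldNormedType.Exports.

Local Open Scope classical_set_scope.
Local Open Scope ring_scope.

Definition is_pmf (R : realType) (X : choiceType) (p : X -> R) : Prop :=
  (forall x, 0 <= p x) /\ (\esum_(x in [set: X]) (p x)%:E = 1)%E.

(* [trans s a s'] is T(s' | s, a). *)
Record mdp (R : realType) (S : finType) (A : countType) := MDP {
  trans : S -> A -> S -> R;
  reward : S -> A -> S -> R;
  init : S -> R;
  discount : R;
  trans_pmf : forall s a, is_pmf (trans s a);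
  init_pmf : is_pmf init;
  discount_ge0 : 0 <= discount;
  discount_lt1 : discount < 1
}.

(* [pi s a] is pi(a | s). *)
Definition is_policy (R : realType) (S : finType) (A : countType)
    (pi : S -> A -> R) : Prop :=
  forall s, is_pmf (pi s).

Definition deterministic (R : realType) (S : finType) (A : countType)
    (f : S -> A) : S -> A -> R :=
  fun s a => (a == f s)%:R.

Definition greedy (R : realType) (S : finType) (A : countType)
    (Q : S -> A -> R) (f : S -> A) : Prop :=
  forall s a, Q s a <= Q s (f s).

(* The real supremum is the maximum over actions whenever the latter exists,
   in particular when A is finite and nonempty. *)
Definition bellman (R : realType) (S : finType) (A : countType)
    (M : mdp R S A) (Q : S -> A -> R) : S -> A -> R :=
  fun s a => \sum_(s' : S) trans M s a s' *
    (reward M s a s' + discount M * sup (range (Q s'))).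

Definition state_action_pmf (R : realType) (S : finType) (A : countType)
    (dmu : S -> R) (mu : S -> A -> R) : S * A -> R :=
  fun x => dmu x.1 * mu x.1 x.2.

Definition norm2 (R : realType) (S : finType) (A : countType)
    (P : S * A -> R) (f : S -> A -> R) : R :=
  Num.sqrt (fine (\esum_(x in [set: S * A]) (P x * f x.1 x.2 ^+ 2)%:E)%E).

(* A realization of the controlled process (S_t, A_t) under the policy pi, on
   an arbitrary probability space, with S_0 distributed as d_0. The field
   [run_law] determines the law of the whole process, so that expectations do
   not depend on the realization; one exists by the Ionescu-Tulcea theorem. *)
Record run (R : realType) (S : finType) (A : countType)
    (M : mdp R S A) (pi : S -> A -> R) := Run {
  run_disp : measure_display;
  run_space : measurableType run_disp;
  run_prob : probability run_space R;
  state_at : nat -> run_space -> S;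
  action_at : nat -> run_space -> A;
  state_measurable : forall t s, measurable [set w | state_at t w = s];
  action_measurable : forall t a, measurable [set w | action_at t w = a];
  run_law : forall (n : nat) (s : nat -> S) (a : nat -> A),
    run_prob [set w | forall t, (t <= n)%N ->
                        state_at t w = s t /\ action_at t w = a t] =
    (init M (s 0%N) * pi (s 0%N) (a 0%N) *
      \prod_(0 <= t < n)
        (trans M (s t) (a t) (s t.+1) * pi (s t.+1) (a t.+1)))%:E
}.

Definition reward_at (R : realType) (S : finType) (A : countType)
    (M : mdp R S A) (pi : S -> A -> R) (r : run M pi) (t : nat)
    (w : run_space r) : R :=
  reward M (state_at t w) (action_at t w) (state_at t.+1 w).

Definition discounted_return (R : realType) (S : finType) (A : countType)
    (M : mdp R S A) (pi : S -> A -> R) (r : run M pi) (w : run_space r) : R :=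
  limn (series (fun t => discount M ^+ t * reward_at t w)).

(* J(pi), computed on the realization r of the process under pi. *)
Definition J (R : realType) (S : finType) (A : countType)
    (M : mdp R S A) (pi : S -> A -> R) (r : run M pi) : R :=
  fine ('E_(run_prob r)[@discounted_return R S A M pi r])%E.

(* Main.v *)
(* Coverage makes the action set finite, so [|Qm - Q*|] attains its maximum [D],
   and [sqrt psi * |f s a| <= ||f||_P <= sup |f|]. As the Bellman operator is a
   [gamma]-contraction for the supremum norm, [(1 - gamma) * D] is at most the
   largest Bellman residual, hence [sqrt psi * (1 - gamma) * D <= eps + delta],
   which is (i). For (ii), the one-step loss of the greedy policy of [Qm],
   measured with [Q*], is at most [2 * D]; telescoping the fixed point equation
   of [Q*] along the process bounds the total loss by [2 * D / (1 - gamma)],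
   and [psi <= sqrt psi] because [psi <= 1]. *)

Require Import Defs.
From mathcomp Require Import finmap measurable_realfun ring lra.

Set Implicit Arguments.
Unset Strict Implicit.
Unset Printing Implicit Defensive.

Import Order.TTheory GRing.Theory Num.Theory.
Import numFieldNormedType.Exports.
Local Open Scope classical_set_scope.
Local Open Scope ring_scope.

(** * Finite enumerations and probability mass functions *)

Lemma exists_maximizer (R : realDomainType) (T : eqType) (f : T -> R) (x0 : T)
    (r : seq T) : exists x, forall y, y \in x0 :: r -> f y <= f x.
Proof.
elim: r x0 => [|y r IH] x0.
  by exists x0 => y; rewrite inE => /eqP ->.
have [x hx] := IH y.
exists (if f x0 <= f x then x else x0) => z; rewrite inE => /predU1P[->|/hx zx].
  by case: ifP.
by case: (leP (f x0)) => // /ltW; apply: le_trans.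
Qed.

(** As [A] is only a [countType], an explicit duplicate-free enumeration [r] stands in for a finite
    type structure on actions and on pairs. *)
Lemma esum_enum (R : realType) (T : choiceType) (r : seq T) (f : T -> R) :
  uniq r -> (forall x, x \in r) -> (forall x, 0 <= f x) ->
  (\esum_(x in [set: T]) (f x)%:E = (\sum_(x <- r) f x)%:E)%E.
Proof.
move=> ur rT f0.
have -> : [set: T] = [set` r] by apply/seteqP; split=> x _ //=; exact: rT.
rewrite esum_fset; first by rewrite -fsbig_seq// sumEFin.
  exact: finite_seq.
by move=> i _; rewrite lee_fin.
Qed.

Lemma pmf_sum_enum (R : realType) (T : choiceType) (r : seq T) (p : T -> R) :
  is_pmf p -> uniq r -> (forall x, x \in r) -> \sum_(x <- r) p x = 1.
Proof. by case=> p0 + ur rT; rewrite (esum_enum ur rT p0) => -[]. Qed.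

Lemma pmf_sum (R : realType) (S : finType) (p : S -> R) :
  is_pmf p -> \sum_s p s = 1.
Proof.
move=> hp; rewrite -big_enum; apply: pmf_sum_enum hp (enum_uniq S) _ => s.
by rewrite mem_enum.
Qed.

Lemma pmf_sum_le1 (R : realType) (T : choiceType) (p : T -> R) (r : seq T) :
  is_pmf p -> uniq r -> \sum_(x <- r) p x <= 1.
Proof.
case=> p0 p1 ur; rewrite -lee_fin -p1; apply: esum_ge.
exists [set` r]; first by split=> //; exact: finite_seq.
by rewrite -fsbig_seq// sumEFin.
Qed.

Lemma pmf_le1 (R : realType) (T : choiceType) (p : T -> R) (x : T) :
  is_pmf p -> p x <= 1.
Proof.
by move=> hp; have := @pmf_sum_le1 _ _ p [:: x] hp; rewrite big_seq1; exact.
Qed.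

(** More than [1 / c] distinct points of mass at least [c] would carry a total mass above 1. This is
    how coverage yields a finite action set. *)
Lemma pmf_lower_bound_enum (R : realType) (T : choiceType) (p : T -> R) (c : R) :
  is_pmf p -> 0 < c -> (forall x, c <= p x) ->
  exists2 r : seq T, uniq r & forall x, x \in r.
Proof.
move=> hp c0 cp; have [] := pselect (finite_set [set: T]).
  case/finite_seqP=> r Tr; exists (undup r); first exact: undup_uniq.
  by move=> x; rewrite mem_undup; have : [set: T] x by []; rewrite Tr.
move=> /(infinite_set_fset (Num.truncn c^-1).+1)[B _ hB].
have := pmf_sum_le1 hp (fset_uniq B).
rewrite leNgt => /negP; case.
apply: (@lt_le_trans _ _ (\sum_(x <- B) c)); last by apply: ler_sum.
rewrite big_const_seq count_predT iter_addr_0 -mulr_natl -ltr_pdivrMr// div1r.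
by rewrite (lt_le_trans (truncnS_gt _))// ler_nat.
Qed.

(** * The weighted quadratic norm over a finite set of pairs *)

Section norm2.
Context (R : realType) (S : finType) (A : countType).
Variables (P : S * A -> R) (r : seq (S * A)).
Hypotheses (ur : uniq r) (rT : forall x, x \in r) (P0 : forall x, 0 <= P x).

Lemma norm2E (f : S -> A -> R) :
  norm2 P f = Num.sqrt (\sum_(x <- r) P x * f x.1 x.2 ^+ 2).
Proof.
by rewrite /norm2 (esum_enum ur rT)// => x; rewrite mulr_ge0// sqr_ge0.
Qed.

Lemma norm2_ge (f : S -> A -> R) (psi : R) : 0 <= psi ->
  (forall x, psi <= P x) -> forall s a, Num.sqrt psi * `|f s a| <= norm2 P f.
Proof.
move=> psi0 psiP s a; rewrite norm2E -sqrtr_sqr -sqrtrM// ler_wsqrtr//.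
rewrite (bigD1_seq (s, a))//= ler_wpDr ?ler_wpM2r ?sqr_ge0//.
by apply: sumr_ge0 => x _; rewrite mulr_ge0// sqr_ge0.
Qed.

Lemma norm2_le (f : S -> A -> R) (D : R) : \sum_(x <- r) P x = 1 ->
  0 <= D -> (forall s a, `|f s a| <= D) -> norm2 P f <= D.
Proof.
move=> P1 D0 fD; rewrite norm2E -[leRHS](ger0_norm D0) -sqrtr_sqr ler_wsqrtr//.
rewrite -[leRHS]mul1r -P1 mulr_suml; apply: ler_sum => x _.
by rewrite ler_wpM2l// -[leLHS]real_normK ?num_real// lerXn2r ?nnegrE.
Qed.
End norm2.

(** * Greedy policies and contraction of the Bellman operator *)

(** A greedy action bounds the range and attains its supremum, so the [sup] in [bellman] is a
    genuine maximum and not a default value. *)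
Lemma sup_range_greedy (R : realType) (S : finType) (A : countType)
  (Q : S -> A -> R) (f : S -> A) s : greedy Q f -> sup (range (Q s)) = Q s (f s).
Proof.
move=> g; apply/eqP; rewrite eq_le; apply/andP; split.
  by apply: ge_sup; [exists (Q s (f s)); exists (f s)|move=> _ [a _ <-]; exact: g].
apply: ub_le_sup; last by exists (f s).
by exists (Q s (f s)) => _ [a _ <-]; exact: g.
Qed.

Lemma pmf_mean_le (R : realType) (S : finType) (p g : S -> R) (D : R) :
  is_pmf p -> (forall s, g s <= D) -> \sum_s p s * g s <= D.
Proof.
move=> hp gD; rewrite -[leRHS]mul1r -(pmf_sum hp) mulr_suml.
by apply: ler_sum => s _; rewrite ler_wpM2l//; case: hp.
Qed.

Lemma bellman_contraction (R : realType) (S : finType) (A : countType)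
    (M : mdp R S A) (Q1 Q2 : S -> A -> R) (f1 f2 : S -> A) (D : R) :
  greedy Q1 f1 -> greedy Q2 f2 -> (forall s a, `|Q1 s a - Q2 s a| <= D) ->
  forall s a, `|bellman M Q1 s a - bellman M Q2 s a| <= discount M * D.
Proof.
(* A one-sided estimate is enough: exchanging the two functions gives the other side of the absolute
   value. *)
have half Q Q' f f' : greedy Q f -> greedy Q' f' ->
    (forall s a, Q s a - Q' s a <= D) ->
    forall s a, bellman M Q s a - bellman M Q' s a <= discount M * D.
  move=> g g' h s a; rewrite /bellman -sumrB.
  under eq_bigr => s' _.
    rewrite -mulrBr (sup_range_greedy _ g) (sup_range_greedy _ g').
    rewrite opprD addrACA subrr add0r -mulrBr; over.
  apply: pmf_mean_le; first exact: trans_pmf.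
  move=> s'; rewrite ler_wpM2l ?discount_ge0//.
  (* Both functions are compared at the maximizer [f s'] of [Q], where [Q'] is at most its own
     maximum. *)
  by have := h s' (f s'); have := g' s' (f s'); lra.
move=> g1 g2 h s a; rewrite ler_norml lerNl opprB.
rewrite (half _ _ _ _ g2 g1) ?(half _ _ _ _ g1 g2)// => t b;
  by have := h t b; rewrite ler_norml; lra.
Qed.

(** * Countably valued maps and integrals over finitely many events *)

Section countable_valued.
Context d (T : measurableType d) (R : realType) (U : countType) (Z : T -> U).
Hypothesis mZ : forall u, measurable [set w | Z w = u].

(** The preimage is a countable union of measurable fibres, whatever the set [B] of values. *)
Lemma countable_valued_preimage_measurable (B : set U) : measurable (Z @^-1` B).
Proof.
have -> : Z @^-1` B = \bigcup_u (if u \in B then [set w | Z w = u] else set0).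
  apply/seteqP; split=> [w Bw|w [u _]].
    by exists (Z w) => //; rewrite mem_set.
  by case: ifPn => [/set_mem Bu /= -> //|_ []].
apply: countable_bigcupT_measurable; first exact: countableP.
by move=> u; case: ifP.
Qed.

Lemma countable_valued_measurable_fun (g : U -> R) :
  measurable_fun [set: T] (g \o Z).
Proof.
move=> _ B _; rewrite setTI comp_preimage.
exact: countable_valued_preimage_measurable.
Qed.
End countable_valued.

Lemma sum_measure_bigcup d (T : measurableType d) (R : realType)
    (P : {measure set T -> \bar R}) (I : finType) (E : I -> set T) :
  (forall i, measurable (E i)) -> trivIset [set: I] E ->
  (P (\bigcup_i E i) = \sum_i P (E i))%E.
Proof.
move=> mE tE; have e : [set: I] = [set` enum I].
  by apply/seteqP; split=> x _ //=; rewrite mem_enum.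
rewrite measure_fin_bigcup//; last by rewrite e; exact: finite_seq.
by rewrite e -fsbig_seq ?enum_uniq// big_enum.
Qed.

(* If disjoint events have probabilities at least [p i] with [\sum_i p i = 1],
   then these are their exact probabilities and the events cover almost
   everything. *)
Lemma integral_finite_law d (T : measurableType d) (R : realType)
    (P : probability T R) (I : finType) (E : I -> set T) (p g : I -> R)
    (X : T -> R) :
  (forall i, measurable (E i)) -> trivIset [set: I] E ->
  (forall i, (p i)%:E <= P (E i))%E -> \sum_i p i = 1 ->
  measurable_fun [set: T] X -> (forall i w, E i w -> X w = g i) ->
  (\int[P]_w (X w)%:E = (\sum_i p i * g i)%:E)%E.
Proof.
move=> mE tE pE p1 mX Xg.
pose U := \bigcup_i E i.
have mU : measurable U.
  by apply: countable_bigcupT_measurable => //; exact: countableP.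
have PU : P U = 1%E.
  apply/eqP; rewrite eq_le probability_le1//= sum_measure_bigcup//.
  rewrite -p1 -sumEFin; exact: lee_sum.
have PE i : P (E i) = (p i)%:E.
  (* A strict excess in one event would push the mass of the disjoint union [U] above 1. *)
  apply/eqP; rewrite eq_le pE andbT leNgt; apply/negP => lt_pE.
  have : (P U > 1)%E; last by rewrite PU ltxx.
  rewrite /U sum_measure_bigcup// (bigD1 i)//=.
  rewrite -p1 (bigD1 i)//= EFinD -sumEFin lte_leD//; first by rewrite sumEFin.
  exact: lee_sum.
(* [Y] is the simple function that agrees with [X] on [U], hence almost everywhere. *)
pose Y w := (\sum_i (g i)%:E * (\1_(E i) w)%:E)%E.
have iY i : P.-integrable [set: T] (fun w => (g i)%:E * (\1_(E i) w)%:E)%E.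
  by apply: integrableZl => //; exact: integrable_indic.
transitivity (\int[P]_w Y w)%E; last first.
  rewrite /Y integral_sum// -sumEFin; apply: eq_bigr => i _.
  rewrite integralZl//; last exact: integrable_indic.
  by rewrite integral_indic// setIT mulrC EFinM; congr (_ * _)%E; exact: PE.
apply: ae_eq_integral => //.
- exact/measurable_EFinP.
- by apply: emeasurable_sum => i; exact: measurable_int (iY i).
exists (~` U); split; first exact: measurableC.
  by transitivity (1 - P U)%E; [exact: probability_setC|rewrite PU subee].
move=> w; apply: contra_not => -[i _ Eiw] _; rewrite /Y (bigD1 i)//= big1.
  by rewrite indicE mem_set//= mule1 adde0 (Xg i).
move=> j ji; rewrite indicE memNset ?mule0// => Ejw.
by move/eqP: ji; apply; apply: (tE j i) => //; exists w.
Qed.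

(** * State distribution of a run under a deterministic policy *)

Section deterministic_run.
Context (R : realType) (S : finType) (A : countType) (M : mdp R S A) (f : S -> A).
Variable r : run M (deterministic R f).

Let step s s' := trans M s (f s) s'.

(** The law of the state at time [n] in the Markov chain induced by [f], by forward recursion. It
    depends on [M] and [f] but not on the realization [r]. *)
Fixpoint state_law (n : nat) : S -> R :=
  if n is n'.+1 then fun s' => \sum_s state_law n' s * step s s' else init M.

Lemma state_law_ge0 n s : 0 <= state_law n s.
Proof.
elim: n s => [|n IH] s /=; first by case: (init_pmf M).
by apply: sumr_ge0 => x _; rewrite mulr_ge0//; case: (trans_pmf M x (f x)) => h _;
  exact: h.
Qed.

Lemma sum_step s : \sum_s' step s s' = 1.
Proof. exact: pmf_sum (trans_pmf M s (f s)). Qed.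

Lemma sum_state_law n : \sum_s state_law n s = 1.
Proof.
elim: n => [|n IH] /=; first exact: pmf_sum (init_pmf M).
rewrite exchange_big/= -IH; apply: eq_bigr => s _.
by rewrite -mulr_sumr sum_step mulr1.
Qed.

(** Leaving the history before time [k] free lets it be summed out one state at a time, by induction
    on [k]. *)
Let visits k n (s : nat -> S) : set (run_space r) :=
  [set w | forall t, (k <= t <= n)%N ->
     state_at t w = s t /\ action_at t w = f (s t)].

Let measurable_visits k n s : measurable (visits k n s).
Proof.
have -> : visits k n s = \bigcap_(t in [set t | (k <= t <= n)%N])
    ([set w | state_at t w = s t] `&` [set w | action_at t w = f (s t)]).
  by apply/seteqP; split.
apply: bigcap_measurableType => t _; apply: measurableI.
  exact: state_measurable.
exact: action_measurable.
Qed.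

(* Summing [run_law] over histories ignores the null event where an action
   differs from [f]; an inequality is enough, since the lower bounds have
   total mass 1 and [integral_finite_law] recovers the equality. *)
Let visits_ge k n s : (k <= n)%N ->
  ((state_law k (s k) * \prod_(k <= t < n) step (s t) (s t.+1))%:E
     <= run_prob r (visits k n s))%E.
Proof.
elim: k s => [|k IH] s kn /=.
  have -> : visits 0 n s = [set w | forall t, (t <= n)%N ->
      state_at t w = s t /\ action_at t w = (f \o s) t] by [].
  rewrite run_law /deterministic eqxx mulr1 lee_fin.
  by under [X in _ <= _ * X]eq_bigr => t _ do rewrite eqxx mulr1.
(* [s_ x] puts the state [x] at time [k]. The events for different [x] are disjoint and all lie in
   the event of the window starting at [k.+1]. *)
pose s_ x t := if t == k then x else s t.
apply: (@le_trans _ _ (\sum_x run_prob r (visits k n (s_ x)))%E).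
  rewrite mulr_suml -sumEFin; apply: lee_sum => x _.
  have := IH (s_ x) (ltnW kn); rewrite (big_ltn kn)/= /s_ eqxx.
  rewrite gtn_eqF// mulrA; congr (_ <= _)%E; congr (_ * _)%:E.
  apply: eq_big_nat => t /andP[kt _].
  by rewrite !gtn_eqF// (leq_trans kt).
rewrite -sum_measure_bigcup//; last first.
  move=> x y _ _ [w [/(_ k) + /(_ k)]].
  rewrite leqnn (ltnW kn) /s_ eqxx => /(_ isT)[<- _] /(_ isT)[<- _] //.
apply: le_measure.
- apply/mem_set.
  by apply: countable_bigcupT_measurable => //; exact: countableP.
- exact/mem_set.
move=> w [x _ h] t /andP[kt tn].
by have := h t; rewrite (ltnW kt) tn /s_ gtn_eqF//; exact.
Qed.

Lemma measurable_transition n (g : S -> A -> S -> R) :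
  measurable_fun [set: run_space r]
    (fun w => g (state_at n w) (action_at n w) (state_at n.+1 w)).
Proof.
pose Z (w : run_space r) := (state_at n w, action_at n w, state_at n.+1 w).
apply: (@countable_valued_measurable_fun _ _ _ _ Z _
  (fun z => g z.1.1 z.1.2 z.2)) => -[[s a] s'].
have -> : [set w | Z w = (s, a, s')] = [set w | state_at n w = s] `&`
    [set w | action_at n w = a] `&` [set w | state_at n.+1 w = s'].
  by apply/seteqP; split=> [w [<- <- <-]//|w [[/= <- <-] <-]].
apply: measurableI; [apply: measurableI|].
- exact: state_measurable.
- exact: action_measurable.
- exact: state_measurable.
Qed.

Lemma integral_transition n (g : S -> A -> S -> R) :
  (\int[run_prob r]_w
     (g (state_at n w) (action_at n w) (state_at n.+1 w))%:E =
   (\sum_s state_law n s * \sum_s' trans M s (f s) s' * g s (f s) s')%:E)%E.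
Proof.
(* Only times [n] and [n.+1] matter to this event. It also prescribes the action at time [n.+1],
   which loses no mass under a deterministic policy. *)
pose E (x : S * S) := visits n n.+1 (fun t => if t == n then x.1 else x.2).
have Ew x w : E x w ->
    [/\ state_at n w = x.1, action_at n w = f x.1 & state_at n.+1 w = x.2].
  move=> Exw.
  have := Exw n.+1; rewrite leqnSn leqnn gtn_eqF// => /(_ isT)[-> _].
  by have := Exw n; rewrite leqnSn leqnn eqxx => /(_ isT)[-> ->].
rewrite (@integral_finite_law _ _ _ _ _ E
  (fun x => state_law n x.1 * step x.1 x.2) (fun x => g x.1 (f x.1) x.2)
  (fun w => g (state_at n w) (action_at n w) (state_at n.+1 w))).
- congr EFin; rewrite -(pair_bigA _ (fun s s' =>
    state_law n s * step s s' * g s (f s) s'))/=.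
  by apply: eq_bigr => s _; rewrite mulr_sumr; apply: eq_bigr => s' _; rewrite mulrA.
- by move=> x; exact: measurable_visits.
- move=> [x x'] [y y'] _ _ [w [/Ew + /Ew]].
  by move=> [/= -> _ ->] [-> _ ->].
- move=> [x x'] /=; have := @visits_ge n n.+1
    (fun t => if t == n then x else x') (leqnSn n).
  by rewrite big_nat1 eqxx gtn_eqF.
- rewrite -(pair_bigA _ (fun s s' => state_law n s * step s s'))/=.
  rewrite -(sum_state_law n); apply: eq_bigr => s _.
  by rewrite -mulr_sumr sum_step mulr1.
- exact: measurable_transition.
- by move=> x w /Ew[-> -> ->].
Qed.

(** * Expected discounted return as a limit of finite sums *)

Variable B : R.
Hypothesis reward_le : forall s a s', `|reward M s a s'| <= B.

Let rho t := \sum_s state_law t s * \sum_s' step s s' * reward M s (f s) s'.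
Let gamma := discount M.
Let gamma_norm_lt1 : `|gamma| < 1.
Proof. by rewrite ger0_norm ?discount_ge0// discount_lt1. Qed.

Let partial_return n (w : run_space r) : R :=
  \sum_(0 <= t < n) gamma ^+ t * reward_at t w.

Let discounted_reward_le t (w : run_space r) :
  `|gamma ^+ t * reward_at t w| <= geometric B gamma t.
Proof.
rewrite normrM normrX ger0_norm ?discount_ge0// [leRHS]mulrC.
by apply: ler_wpM2l; [rewrite exprn_ge0 ?discount_ge0|exact: reward_le].
Qed.

Let partial_return_le n w : `|partial_return n w| <= B / (1 - gamma).
Proof.
(* The sign of [B] comes from the reward at time 0 along [w]. *)
have B0 : 0 <= B.
  by have := le_trans (normr_ge0 _) (discounted_reward_le 0 w); rewrite /= mulr1.
have g1 : 0 < 1 - gamma by rewrite subr_gt0 discount_lt1.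
apply: le_trans (ler_norm_sum _ _ _) _.
apply: (@le_trans _ _ (series (geometric B gamma) n)).
  by apply: ler_sum => t _; exact: discounted_reward_le.
rewrite geometric_seriesE ?lt_eqF ?discount_lt1//= -mulrA ler_wpM2l//.
rewrite ler_pdivrMr// mulVf ?gt_eqF//.
by rewrite lerBlDr lerDl exprn_ge0 ?discount_ge0.
Qed.

Let partial_return_cvg w :
  partial_return n w @[n --> \oo] --> discounted_return w.
Proof.
apply: normed_cvg.
apply: (@series_le_cvg _ _ (geometric B gamma)) => //.
- by move=> n; exact: normr_ge0.
- by move=> n; exact: le_trans (normr_ge0 _) (discounted_reward_le n w).
- by move=> n; exact: discounted_reward_le.
- exact: is_cvg_geometric_series.
Qed.

Let measurable_discounted_reward t :
  measurable_fun [set: run_space r] (fun w => gamma ^+ t * reward_at t w).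
Proof.
exact: (measurable_transition t (fun s a s' => gamma ^+ t * reward M s a s')).
Qed.

Let measurable_partial_return n :
  measurable_fun [set: run_space r] (partial_return n).
Proof. by apply: measurable_sum => t; exact: measurable_discounted_reward. Qed.

Let integral_partial_return n :
  (\int[run_prob r]_w (partial_return n w)%:E =
   (\sum_(0 <= t < n) gamma ^+ t * rho t)%:E)%E.
Proof.
under eq_integral => w _ do rewrite -sumEFin.
rewrite -sumEFin integral_sum//=.
  apply: eq_bigr => t _.
  rewrite (integral_transition t (fun s a s' => gamma ^+ t * reward M s a s')).
  rewrite mulr_sumr; congr EFin; apply: eq_bigr => s _.
  rewrite [RHS]mulrCA; congr (_ * _).
  by rewrite mulr_sumr; apply: eq_bigr => s' _; rewrite mulrCA.
move=> t; apply: measurable_bounded_integrable => //.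
  exact: le_lt_trans (probability_le1 (run_prob r) measurableT) (ltry 1).
exists (geometric B gamma t); split; first exact: num_real.
by move=> x Bx w _; exact: le_trans (discounted_reward_le t w) (ltW Bx).
Qed.

(** Dominated convergence: the partial returns converge pointwise and are bounded by the constant
    [B / (1 - gamma)], which is integrable for a probability. *)
Lemma J_cvg : (\sum_(0 <= t < n) gamma ^+ t * rho t) @[n --> \oo] --> J r.
Proof.
have mG : measurable_fun [set: run_space r] (@discounted_return _ _ _ _ _ r).
  by apply: measurable_fun_cvg => [n|w _];
    [exact: measurable_partial_return|exact: partial_return_cvg].
have [|||||iG _ cvg_int] := @dominated_convergence _ _ _ (run_prob r) setT
    measurableT (fun n w => (partial_return n w)%:E)
    (fun w => (discounted_return w)%:E) (cst (B / (1 - gamma))%:E).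
- by move=> n; exact/measurable_EFinP.
- exact/measurable_EFinP.
- by apply: aeW => w _; apply: cvg_EFin; [exact: nearW|exact: partial_return_cvg].
- exact: finite_measure_integrable_cst.
- by apply: aeW => w n _; rewrite lee_fin partial_return_le.
(* The limit is integrable, so the [fine] in [J] loses nothing. *)
move: cvg_int; rewrite -(fineK (integrable_fin_num measurableT iG)) => /fine_cvg.
rewrite (_ : fine \o _ = fun n => \sum_(0 <= t < n) gamma ^+ t * rho t).
  by rewrite /J expectation.unlock.
by apply/funext => n; rewrite /= integral_partial_return.
Qed.
End deterministic_run.

(** * Loss of a policy relative to a fixed point of the Bellman operator *)

(* Writing [V s = Q s (g s)], the fixed point equation makes the expected
   reward at time [t] equal to
   [E V(S_t) - gamma E V(S_(t+1)) - E (V(S_t) - Q(S_t, f S_t))], so the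
   discounted sum telescopes. *)
Section optimality_gap.
Context (R : realType) (S : finType) (A : countType) (M : mdp R S A)
  (Q : S -> A -> R) (f g : S -> A) (r : run M (deterministic R f)) (B : R).
Hypotheses (bellman_fix : bellman M Q = Q) (g_greedy : greedy Q g).
Hypothesis reward_le : forall s a s', `|reward M s a s'| <= B.

Let gamma := discount M.
Let p t := state_law M f t.
Let V t := \sum_s p t s * Q s (g s).
Let gap t := \sum_s p t s * (Q s (g s) - Q s (f s)).

Let expected_reward t :
  \sum_s p t s * \sum_s' trans M s (f s) s' * reward M s (f s) s' =
  V t - gamma * V t.+1 - gap t.
Proof.
(* The expectation at time [t.+1] is computed by conditioning on the state at time [t]. *)
have -> : V t.+1 =
    \sum_s p t s * \sum_s' trans M s (f s) s' * Q s' (g s').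
  rewrite /V /p /=; under eq_bigr => s' _ do rewrite mulr_suml.
  rewrite exchange_big/=; apply: eq_bigr => s _; rewrite mulr_sumr.
  by apply: eq_bigr => s' _; rewrite mulrA.
rewrite /V /gap mulr_sumr -!sumrB; apply: eq_bigr => s _.
have -> : Q s (f s) = \sum_s' trans M s (f s) s' * reward M s (f s) s' +
    gamma * \sum_s' trans M s (f s) s' * Q s' (g s').
  rewrite -{1}bellman_fix /bellman mulr_sumr -big_split/=.
  apply: eq_bigr => s' _.
  by rewrite (sup_range_greedy _ g_greedy) mulrDr mulrCA.
ring.
Qed.

Let telescope n :
  \sum_(0 <= t < n) gamma ^+ t *
    \sum_s p t s * \sum_s' trans M s (f s) s' * reward M s (f s) s' =
  V 0 - gamma ^+ n * V n - \sum_(0 <= t < n) gamma ^+ t * gap t.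
Proof.
elim: n => [|n IH]; first by rewrite !big_nil expr0; ring.
by rewrite !big_nat_recr//= IH expected_reward exprS; ring.
Qed.

Let return_cvg :
  (V 0 - gamma ^+ n * V n - \sum_(0 <= t < n) gamma ^+ t * gap t)
    @[n --> \oo] --> J r.
Proof.
have := @J_cvg _ _ _ _ _ r _ reward_le.
by under eq_fun => n do rewrite telescope.
Qed.

(** A bound on [V t] uniform in [t], so that the remainder of the telescoping is dominated by a
    geometric sequence. *)
Let K := \sum_s `|Q s (g s)|.

Let value_le t : `|V t| <= K.
Proof.
apply: le_trans (ler_norm_sum _ _ _) _; apply: ler_sum => s _.
rewrite normrM ger0_norm ?state_law_ge0// ler_piMl//.
rewrite -(sum_state_law M f t) (bigD1 s)//= lerDl.
by apply: sumr_ge0 => x _; exact: state_law_ge0.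
Qed.

Let remainder_cvg : geometric K gamma n @[n --> \oo] --> (0 : R).
Proof.
by apply: cvg_geometric; rewrite ger0_norm ?discount_ge0 ?discount_lt1.
Qed.

Let remainder_le n : `|gamma ^+ n * V n| <= geometric K gamma n.
Proof.
rewrite normrM normrX ger0_norm ?discount_ge0//= [leRHS]mulrC.
by rewrite ler_wpM2l ?exprn_ge0 ?discount_ge0.
Qed.

(** Every gap is nonnegative because [g] is greedy; dropping the gaps and letting [n] grow leaves
    [V 0]. *)
Lemma J_le_optimal : J r <= \sum_s init M s * Q s (g s).
Proof.
have c : V 0 + geometric K gamma n @[n --> \oo] --> V 0 + 0.
  by apply: cvgD; [exact: cvg_cst|exact: remainder_cvg].
rewrite -[leRHS]addr0; apply: ler_cvg_to return_cvg c _; apply: nearW => n.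
have : 0 <= \sum_(0 <= t < n) gamma ^+ t * gap t.
  apply: sumr_ge0 => t _; rewrite mulr_ge0 ?exprn_ge0 ?discount_ge0//.
  by apply: sumr_ge0 => s _; rewrite mulr_ge0 ?state_law_ge0// subr_ge0.
have := remainder_le n; rewrite ler_norml => /andP[]; lra.
Qed.

(** Each mean gap is at most [b], so the discounted gaps sum to at most the geometric total
    [b / (1 - gamma)]. *)
Lemma J_ge_optimal (b : R) : 0 <= b ->
  (forall s, Q s (g s) - Q s (f s) <= b) ->
  \sum_s init M s * Q s (g s) - b / (1 - gamma) <= J r.
Proof.
move=> b0 gap_le.
have c : V 0 - b / (1 - gamma) - geometric K gamma n @[n --> \oo] -->
    V 0 - b / (1 - gamma) - 0.
  by apply: cvgB; [exact: cvg_cst|exact: remainder_cvg].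
rewrite -[leLHS]subr0; apply: ler_cvg_to c return_cvg _; apply: nearW => n.
have : \sum_(0 <= t < n) gamma ^+ t * gap t <= b / (1 - gamma).
  apply: (@le_trans _ _ (series (geometric b gamma) n)).
    apply: ler_sum => t _; rewrite /= [leRHS]mulrC.
    rewrite ler_wpM2l ?exprn_ge0 ?discount_ge0//.
    apply: pmf_mean_le gap_le; split; first exact: state_law_ge0.
    by rewrite (@esum_enum _ _ (enum S)) ?enum_uniq//;
      [rewrite big_enum/= sum_state_law|move=> s; rewrite mem_enum|
       exact: state_law_ge0].
  rewrite geometric_seriesE ?lt_eqF ?discount_lt1//= -mulrA ler_wpM2l//.
  rewrite ler_pdivrMr ?subr_gt0 ?discount_lt1//.
  rewrite mulVf ?subr_eq0 ?gt_eqF ?discount_lt1//.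
  by rewrite lerBlDr lerDl exprn_ge0 ?discount_ge0.
have := remainder_le n; rewrite ler_norml => /andP[]; lra.
Qed.
End optimality_gap.

(** * Bounds on the Q-function error and on the policy loss *)

Theorem proposition4p1 (R : realType) (S : finType) (A : countType)
    (M : mdp R S A)
    (dmu : S -> R) (mu : S -> A -> R)
    (hdmu : is_pmf dmu) (hmu : is_policy mu)
    (psi : R) (hpsi : 0 < psi)
    (hcover : forall s a, psi <= state_action_pmf dmu mu (s, a))
    (Qm : S -> A -> R) (mhat : (S -> A -> R) -> R) (epsilon delta : R)
    (hepsilon : mhat Qm <= epsilon)
    (hdelta : `|mhat Qm - norm2 (state_action_pmf dmu mu)
                            (fun s a => Qm s a - bellman M Qm s a)| <= delta)
    (Qstar : S -> A -> R) (hQstar : bellman M Qstar = Qstar)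
    (pistar pim : S -> A)
    (hpistar : greedy Qstar pistar) (hpim : greedy Qm pim)
    (rstar : run M (deterministic R pistar))
    (rm : run M (deterministic R pim)) :
  norm2 (state_action_pmf dmu mu) (fun s a => Qm s a - Qstar s a) <=
    1 / (Num.sqrt psi * (1 - discount M)) * (epsilon + delta)
  /\
  J rstar - J rm <= 2 / (psi * (1 - discount M) ^+ 2) * (epsilon + delta).
Proof.
set P := state_action_pmf dmu mu; set gamma := discount M.
have psiP x : psi <= P x by case: x => s a; exact: hcover.
have P0 x : 0 <= P x by exact: le_trans (ltW hpsi) (psiP x).
(* An empty state space would give [dmu] total mass 0. *)
have [s0 _ | S0] := pickP (@predT S); last first.
  have := pmf_sum hdmu; rewrite big1 => [/esym/eqP|s _]; first by rewrite oner_eq0.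
  by have := S0 s.
(* Since [dmu s0 <= 1], coverage passes to [mu s0], which makes the action set finite. *)
have psi_mu a : psi <= mu s0 a.
  apply: le_trans (hcover s0 a) _.
  by rewrite /state_action_pmf/= ler_piMl ?pmf_le1//; case: (hmu s0).
have [l ul lT] := pmf_lower_bound_enum (hmu s0) hpsi psi_mu.
pose r := [seq (s, a) | s <- enum S, a <- l].
have ur : uniq r by rewrite allpairs_uniq ?enum_uniq// => -[? ?] [? ?].
have rT x : x \in r.
  by case: x => s a; apply/allpairsP; exists (s, a); rewrite mem_enum lT.
have P1 : \sum_(x <- r) P x = 1.
  rewrite big_allpairs big_enum/= -(pmf_sum hdmu); apply: eq_bigr => s _.
  by rewrite /P /state_action_pmf/= -mulr_sumr pmf_sum_enum ?mulr1.
(* Finitely many transitions bound the reward, as dominated convergence of the returns requires. *)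
have [B reward_le] : exists B : R, forall s a s', `|reward M s a s'| <= B.
  have [x hx] := exists_maximizer
    (fun x : S * A * S => `|reward M x.1.1 x.1.2 x.2|) (s0, pim s0, s0)
    [seq (x, s) | x <- r, s <- enum S].
  eexists => s a s'; apply: (hx (s, a, s')); rewrite inE; apply/orP; right.
  by apply/allpairsP; exists ((s, a), s'); rewrite rT mem_enum.
have [x0 hx0] := exists_maximizer
  (fun x : S * A => `|Qm x.1 x.2 - Qstar x.1 x.2|) (s0, pim s0) r.
set D : R := `|Qm x0.1 x0.2 - Qstar x0.1 x0.2| in hx0.
have D0 : 0 <= D by exact: normr_ge0.
have QD s a : `|Qm s a - Qstar s a| <= D.
  by apply: (hx0 (s, a)); rewrite inE rT orbT.
have g1 : 0 < 1 - gamma by rewrite subr_gt0 discount_lt1.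
have sq0 : 0 < Num.sqrt psi by rewrite sqrtr_gt0.
have De : Num.sqrt psi * ((1 - gamma) * D) <= epsilon + delta.
  have residual_le :
      norm2 P (fun s a => Qm s a - bellman M Qm s a) <= epsilon + delta.
    by move: hdelta; rewrite ler_norml => /andP[]; lra.
  apply: le_trans residual_le.
  apply: le_trans (norm2_ge ur rT P0 _ (ltW hpsi) psiP x0.1 x0.2).
  rewrite ler_wpM2l ?sqrtr_ge0//.
  (* At the maximizer [x0], the triangle inequality bounds [D] by the Bellman residual there plus
     [gamma * D]. *)
  have := bellman_contraction M hpim hpistar QD x0.1 x0.2.
  rewrite hQstar; have := ler_normD (Qm x0.1 x0.2 - bellman M Qm x0.1 x0.2)
    (bellman M Qm x0.1 x0.2 - Qstar x0.1 x0.2).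
  by rewrite addrA subrK -/D -/gamma; lra.
have D_le : D <= 1 / (Num.sqrt psi * (1 - gamma)) * (epsilon + delta).
  by rewrite mulrAC mul1r ler_pdivlMr ?mulr_gt0// mulrC -mulrA.
split; first exact: le_trans (norm2_le ur rT P0 P1 D0 QD) D_le.
have psi1 : psi <= 1.
  by apply: le_trans (psi_mu (pim s0)) _; exact: pmf_le1.
have psi_sqrt : psi <= Num.sqrt psi.
  rewrite -{1}(sqr_sqrtr (ltW hpsi)) expr2 ler_piMl ?sqrtr_ge0//.
  by rewrite -sqrtr1 ler_wsqrtr.
(* Passing from [Qstar] to [Qm] and back costs [D] each time, and [Qm] prefers [pim s] to
   [pistar s]. *)
have gap_le s : Qstar s (pistar s) - Qstar s (pim s) <= 2 * D.
  have := QD s (pistar s); have := QD s (pim s); have := hpim s (pistar s).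
  by rewrite !ler_norml => ? /andP[? ?] /andP[? ?]; lra.
(* Both returns are compared with the mean of [Qstar s (pistar s)] under [init M]. *)
apply: (@le_trans _ _ (2 * D / (1 - gamma))).
  have := J_le_optimal rstar hQstar hpistar reward_le.
  have := J_ge_optimal rm hQstar hpistar reward_le _ gap_le.
  by rewrite mulr_ge0// => /(_ isT); rewrite -/gamma; lra.
have D_le_psi : D <= (epsilon + delta) / (psi * (1 - gamma)).
  rewrite ler_pdivlMr ?mulr_gt0// mulrC -mulrA; apply: le_trans De.
  by rewrite ler_wpM2r// mulr_ge0 ?(ltW g1).
rewrite ler_pdivrMr//.
rewrite (_ : _ * (1 - gamma) = 2 * ((epsilon + delta) / (psi * (1 - gamma)))).
  by rewrite ler_wpM2l.
by field; rewrite !gt_eqF.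
Qed.
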